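(* Let $G$ be a connected graph with $\operatorname{diam}(G)\leq 2$. Then (i) $\mathrm{lec}(G)=1$ if $G=K_n$ for some $n\geq 2$; and (ii) otherwise $2\leq \mathrm{lec}(G)\leq \max\{3,\Delta(C(G))\}$. Moreover, all three bounds (the values $2$, $3$ and $\Delta(C(G))$) are attained.
   Context: Graphs are finite, simple, undirected. Given an edge-colouring $\varphi:E(G)\to[1,k]$, a path is loose if it consists of exactly one edge, or of exactly two edges of different colours, or has at least three edges coloured with at least three distinct colours. $\mathrm{lec}(G)$ is the least $k$ for which there is an edge-colouring with $k$ colours such that every two distinct vertices are joined by a loose path. The cut-edge graph $C(G)$ is the graph whose edges are the cut-edges (bridges) of $G$ and whose vertices are their endpoints; $\Delta(C(G))$ is its maximum degree ($0$ if $G$ has no cut-edges). *)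

(* Defs.v *)
From HB Require Import structures.
From mathcomp Require Import all_boot.
Set Implicit Arguments.
Unset Strict Implicit.
Unset Printing Implicit Defensive.

Record sgraph := SGraph {
  vertex :> finType;
  adj : rel vertex;
  adj_sym : symmetric adj;
  adj_irrefl : irreflexive adj }.

Notation "x -- y" := (adj x y) (at level 30).

Definition edges (G : sgraph) : {set {set G}} :=
  [set A | [exists x : G, exists y : G, (x -- y) && (A == [set x; y])]].

Lemma mem_edges (G : sgraph) (x y : G) : ([set x; y] \in edges G) = (x -- y).
Proof.
rewrite inE; apply/existsP/idP => [[u /existsP[v /andP[uv /eqP/setP E]]]|xy].
  2: by exists x; apply/existsP; exists y; rewrite xy eqxx.
have uvn : u != v by apply: contraTneq uv => ->; rewrite adj_irrefl.
have : u \in [set x; y] by rewrite E !inE eqxx.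
have : v \in [set x; y] by rewrite E !inE eqxx orbT.
rewrite !inE => /orP[]/eqP Ev /orP[]/eqP Eu; subst => //.
- by rewrite eqxx in uvn.
- by rewrite adj_sym.
- by rewrite eqxx in uvn.
Qed.

Definition sg_iso (G H : sgraph) : Prop :=
  exists2 f : G -> H, bijective f & forall x y, (f x -- f y) = (x -- y).

Lemma complete_sym n : symmetric (fun x y : 'I_n => x != y).
Proof. by move=> x y; rewrite eq_sym. Qed.

Lemma complete_irrefl n : irreflexive (fun x y : 'I_n => x != y).
Proof. by move=> x; rewrite eqxx. Qed.

Definition complete (n : nat) : sgraph :=
  SGraph (@complete_sym n) (@complete_irrefl n).

Definition connected (G : sgraph) : bool :=
  (0 < #|G|) && [forall x : G, forall y : G, connect (@adj G) x y].

(* The least length of a walk from x to y; it is #|G|, larger than any         *)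
(* distance, when x and y lie in different components.                        *)
Definition dist (G : sgraph) (x y : G) : nat :=
  find (fun n => [exists p : n.-tuple G, path (@adj G) x p && (last x p == y)])
       (iota 0 #|G|).

Definition diam (G : sgraph) : nat := \max_(x : G) \max_(y : G) dist x y.

Definition max_degree (G : sgraph) : nat := \max_(x : G) #|[set y | x -- y]|.

Definition del_edge (G : sgraph) (A : {set G}) : rel G :=
  [rel u v | (u -- v) && ([set u; v] != A)].

Definition cut_edge (G : sgraph) (A : {set G}) : bool :=
  (A \in edges G) && (n_comp (@adj G) predT < n_comp (del_edge A) predT).

Definition cut_vertex_type (G : sgraph) : finType :=
  {x : G | [exists A : {set G}, cut_edge A && (x \in A)]}.

Definition cut_adj (G : sgraph) : rel (cut_vertex_type G) :=
  [rel x y | cut_edge [set val x; val y]].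

Lemma cut_adj_sym (G : sgraph) : symmetric (@cut_adj G).
Proof. by move=> x y; rewrite /cut_adj /= setUC. Qed.

Lemma cut_adj_irrefl (G : sgraph) : irreflexive (@cut_adj G).
Proof. by move=> x; rewrite /cut_adj /= /cut_edge mem_edges adj_irrefl. Qed.

Definition cut_graph (G : sgraph) : sgraph :=
  SGraph (@cut_adj_sym G) (@cut_adj_irrefl G).

Section Loose.
Variables (G : sgraph) (k : nat).

(* A colouring takes values in {0..k} on all vertex sets; being positive on    *)
(* the edges makes it a map from E(G) to [1,k], and its other values are       *)
(* irrelevant.                                                                *)
Definition edge_colouring (phi : {ffun {set G} -> 'I_k.+1}) : bool :=
  [forall A in edges G, 0 < phi A].

Definition path_colours (phi : {ffun {set G} -> 'I_k.+1}) (x : G) (p : seq G) :=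
  pairmap (fun u v => phi [set u; v]) x p.

Definition loose (cs : seq 'I_k.+1) : bool :=
  [|| size cs == 1, (size cs == 2) && uniq cs |
      (3 <= size cs) && (3 <= size (undup cs))].

(* The path is x :: p; having no repeated vertex it satisfies size p < #|G|,   *)
(* so bounding its length by #|G| loses nothing.                              *)
Definition loose_joined (phi : {ffun {set G} -> 'I_k.+1}) (x y : G) : bool :=
  [exists p : #|G|.-bseq G,
    [&& path (@adj G) x p, uniq (x :: p), last x p == y &
        loose (path_colours phi x p)]].

Definition loose_colourable : bool :=
  [exists phi, edge_colouring phi &&
    [forall x : G, forall y : G, (x != y) ==> loose_joined phi x y]].

End Loose.

(* Search up to the number of edges, which suffices for connected graphs       *)
(* (lecP); the value for a disconnected graph is meaningless.                 *)
Definition lec (G : sgraph) : nat :=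
  find (loose_colourable G) (iota 0 #|edges G|.+1).

Lemma connected_loose_colourable (G : sgraph) :
  connected G -> loose_colourable G #|edges G|.
Proof.
case/andP=> _ /forallP conn.
pose f (A : {set G}) : 'I_#|edges G|.+1 := inord (index A (enum (edges G))).+1.
have fE A : A \in edges G -> f A = (index A (enum (edges G))).+1 :> nat.
  by move=> AE; rewrite inordK // ltnS cardE index_mem mem_enum.
have finj A B : A \in edges G -> B \in edges G -> f A = f B -> A = B.
  move=> AE BE /(congr1 val) /=; rewrite !fE // => -[] /index_inj.
  by move=> inj; apply: inj => /=; rewrite ?mem_enum.
apply/existsP; exists (finfun f); apply/andP; split.
  by apply/forall_inP => A AE; rewrite ffunE fE.
apply/forallP=> x; apply/forallP=> y; apply/implyP=> xy.
have /forallP/(_ y) /connectP[p0 px0 ylast] := conn x.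
move: ylast; case/shortenP: px0 => p px up _ ylast.
have sp : size p <= #|G|.
  by have := max_card (mem (x :: p)); rewrite (card_uniqP up) /=; apply: ltnW.
apply/existsP; exists (Bseq sp) => /=.
have up' := up; rewrite /= in up'; rewrite px up' ylast eqxx /=.
have sub : forall u q, path (@adj G) u q -> forall c,
    c \in path_colours (finfun f) u q ->
    exists A, [/\ A \in edges G, A \subset u :: q & c = f A].
  move=> u q; elim: q u => //= v q IH u /andP[uv vq] c.
  rewrite /path_colours /= inE => /orP[/eqP->|].
    exists [set u; v]; rewrite mem_edges ffunE; split=> //.
    by apply/subsetP=> z; rewrite !inE => /orP[]->; rewrite ?orbT.
  move=> /(IH _ vq)[A [AE As ->]]; exists A; split=> //.
  apply: subset_trans As _; apply/subsetP=> z; rewrite !inE => ->.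
  by rewrite orbT.
have ucs : forall u q, path (@adj G) u q -> uniq (u :: q) ->
    uniq (path_colours (finfun f) u q).
  move=> u q; elim: q u => //= v q IH u /andP[uv vq] /andP[uq uvq].
  rewrite /path_colours /= IH // andbT; apply/negP => /(sub _ _ vq)[A [AE As]].
  rewrite ffunE => /finj E; have {}E : [set u; v] = A.
    by apply: E; rewrite ?mem_edges.
  by move/subsetP: As => /(_ u); rewrite -E !inE eqxx /= => /(_ isT);
     move: uq; rewrite inE => /negPf->.
have {}ucs := ucs _ _ px up.
have scs : size (path_colours (finfun f) x p) = size p by rewrite size_pairmap.
rewrite /loose undup_id // ucs scs andbT.
case: p {sp px up up' ucs scs} ylast => [|a [|b [|c p]]] //= E.
by rewrite E eqxx in xy.
Qed.

Lemma lecP (G : sgraph) : connected G ->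
  loose_colourable G (lec G) /\
  forall k, loose_colourable G k -> lec G <= k.
Proof.
move=> /connected_loose_colourable col.
have hasl : has (loose_colourable G) (iota 0 #|edges G|.+1).
  by apply/hasP; exists #|edges G|; rewrite ?mem_iota ?add0n ?leqnn.
have ltl := hasl; rewrite has_find size_iota in ltl.
split=> [|k colk].
  by have := nth_find 0 hasl; rewrite nth_iota.
rewrite leqNgt; apply/negP => lt; have := before_find 0 lt.
by rewrite nth_iota ?colk //; apply: ltn_trans lt ltl.
Qed.

(* Main.v *)
Require Import Defs.
From mathcomp Require Import all_boot.
Set Implicit Arguments.
Unset Strict Implicit.
Unset Printing Implicit Defensive.

(** In a graph of diameter at most 2 a cut-edge, or any cut-vertex, forces a
    universal vertex.  If [u] is universal, give the edges from [u] to its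
    leaves distinct colours, split the other neighbours of [u] into two classes
    such that each one has a neighbour in the opposite class, colour the edges
    from [u] to them 1 or 2 by class, and give colour 3 to the edges avoiding
    [u]: two vertices [x], [y] with [ux], [uy] of equal colour are joined by
    [x u y' y] with [y'] in the other class.

    If no vertex is universal, take an edge [st] of colour 1, colour the other
    edges at [t] with 3 and all the rest with 2.  Nonadjacent [x], [y] outside
    [s], [t] are joined to [s], [t], in some order, by disjoint paths, and
    together with [st] these form a path using all three colours.

    The bounds are attained by stars, where two leaves are joined by a single
    path, and by the 5-cycle, which cannot be 2-coloured as its consecutive
    edges would have to alternate. *)

(** * Distances and adjacency *)

Lemma adj_neq (G : sgraph) (x y : G) : x -- y -> x != y.
Proof. by apply: contraTneq => ->; rewrite adj_irrefl. Qed.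

Definition within2 (G : sgraph) (x y : G) : Prop :=
  [\/ x = y, x -- y | exists2 z, x -- z & z -- y].

(** A connecting path without repeated vertices has fewer than [#|G|] edges, so the search in [dist]
    succeeds and returns the length of an actual walk, here of at most two edges. *)
Lemma diam2_within2 (G : sgraph) : connected G -> diam G <= 2 ->
  forall x y : G, within2 x y.
Proof.
case/andP=> _ /forallP conn dG x y.
pose P n := [exists p : n.-tuple G, path (@adj G) x p && (last x p == y)].
have hasP : has P (iota 0 #|G|).
  have /forallP/(_ y)/connectP[p0 px0 ylast] := conn x.
  move: ylast; case/shortenP: px0 => p px up _ ylast.
  apply/hasP; exists (size p).
    rewrite mem_iota add0n /=.
    by have := max_card (mem (x :: p)); rewrite (card_uniqP up).
  by apply/existsP; exists (in_tuple p); rewrite px ylast eqxx.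
have ltd : dist x y < #|G| by rewrite has_find size_iota in hasP.
have := nth_find 0 hasP; rewrite -/(dist x y) nth_iota // add0n.
have : dist x y <= 2.
  apply: leq_trans dG; rewrite /diam.
  exact: (leq_trans (leq_bigmax (F := fun y => dist x y) y)
                    (leq_bigmax (F := fun x => \max_y dist x y) x)).
move=> le2 /existsP[[p /eqP sp]] /=.
case: p sp => [|a [|b [|c p]]] /= sp; last by rewrite -sp in le2.
- by move/eqP; constructor 1.
- by rewrite andbT => /andP[xa /eqP <-]; constructor 2.
- by case/andP=> /and3P[xa ab _] /eqP <-; constructor 3; exists a.
Qed.

Lemma within2_connected (G : sgraph) : 0 < #|G| ->
  (forall x y : G, within2 x y) -> connected G.
Proof.
move=> G0 w; rewrite /connected G0; apply/forallP=> x; apply/forallP=> y.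
case: (w x y) => [->|xy|[z xz zy]]; first exact: connect0.
  exact: connect1.
exact: connect_trans (connect1 xz) (connect1 zy).
Qed.

Lemma within2_diam (G : sgraph) : 2 < #|G| ->
  (forall x y : G, within2 x y) -> diam G <= 2.
Proof.
move=> G2 w; apply/bigmax_leqP => x _; apply/bigmax_leqP => y _.
have le_dist (p : seq G) : path (@adj G) x p -> last x p = y ->
    size p <= 2 -> dist x y <= 2.
  move=> px ly sp; apply: leq_trans sp; rewrite leqNgt; apply/negP => lt.
  (* A failed search returns [#|G|], so [dist] never exceeds it and [size p] lies in the searched
     range. *)
  have lts : size p < #|G|.
    by apply: leq_trans lt _; apply: leq_trans (find_size _ _) _; rewrite size_iota.
  have := before_find 0 lt; rewrite nth_iota // add0n.
  move/existsP; apply; exists (in_tuple p) => /=; by rewrite px ly eqxx.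
case: (w x y) => [E|xy|[z xz zy]].
- exact: (le_dist [::]).
- by apply: (le_dist [:: y]) => //=; rewrite xy.
- by apply: (le_dist [:: z; y]) => //=; rewrite xz zy.
Qed.

Lemma complete_adj (G : sgraph) n : sg_iso G (complete n) ->
  forall x y : G, (x -- y) = (x != y).
Proof.
move=> [f bf fE] x y; rewrite -fE /=.
by rewrite (inj_eq (bij_inj bf)).
Qed.

Lemma not_complete_nonadj (G : sgraph) : 2 <= #|G| ->
  ~ (exists2 n, 2 <= n & sg_iso G (complete n)) ->
  exists x y : G, x != y /\ ~~ (x -- y).
Proof.
move=> G2 nK.
have [/existsP[x /existsP[y /andP[]]]|N] :=
  boolP [exists x : G, exists y : G, (x != y) && ~~ (x -- y)].
  by exists x, y.
case: nK; exists #|G| => //; exists enum_rank; first exact: enum_rank_bij.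
move=> x y /=; rewrite (inj_eq enum_rank_inj).
have [->|xy] := eqVneq x y; first by rewrite adj_irrefl.
apply/esym; apply: contraNT N => nxy.
by apply/existsP; exists x; apply/existsP; exists y; rewrite xy.
Qed.

Lemma nonadj_not_complete (G : sgraph) (x y : G) : x != y -> ~~ (x -- y) ->
  ~ (exists2 n, 2 <= n & sg_iso G (complete n)).
Proof. by move=> xy nxy [n _ /complete_adj E]; rewrite E xy in nxy. Qed.

(** * Loose paths *)

Section Loose.
Variables (G : sgraph) (k : nat).
Implicit Types (phi : {ffun {set G} -> 'I_k.+1}) (x y : G).

Lemma loose_joinedI phi x y (p : seq G) :
  path (@adj G) x p -> uniq (x :: p) -> last x p = y ->
  loose (path_colours phi x p) -> loose_joined phi x y.
Proof.
move=> px up ly lp.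
have sp : size p <= #|G|.
  by have := max_card (mem (x :: p)); rewrite (card_uniqP up) => /ltnW.
by apply/existsP; exists (Bseq sp); rewrite px up lp ly eqxx.
Qed.

Lemma path_colours_rev phi x p :
  path_colours phi (last x p) (rev (belast x p)) = rev (path_colours phi x p).
Proof.
rewrite /path_colours; elim: p x => //= a p IH x.
rewrite !rev_cons -!cats1 pairmap_cat IH /= setUC; congr (_ ++ [:: phi (_ :|: [set _])]).
by case: p {IH} => //= b p; rewrite rev_cons last_rcons.
Qed.

Lemma loose_joinedC phi x y : loose_joined phi x y -> loose_joined phi y x.
Proof.
case/existsP=> -[p sp] /= /andP[px /andP[up /andP[/eqP ly lp]]].
have rE : y :: rev (belast x p) = rev (x :: p) by rewrite (lastI x) rev_rcons ly.
apply: (@loose_joinedI _ _ _ (rev (belast x p))).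
- rewrite -ly rev_path; apply: sub_path px => u v; by rewrite adj_sym.
- by rewrite rE rev_uniq.
- by case: p {sp px up lp} rE ly => [|a p] //= _ _; rewrite rev_cons last_rcons.
- rewrite -ly path_colours_rev; move: lp; rewrite /loose size_rev rev_uniq.
  by rewrite (perm_size (perm_undup (mem_rev _))).
Qed.

Lemma loose_joined1 phi x y : x -- y -> loose_joined phi x y.
Proof.
move=> xy; apply: (@loose_joinedI _ _ _ [:: y]) => //=; first by rewrite xy.
by rewrite inE andbT adj_neq.
Qed.

Lemma loose_joined2 phi x z y : x -- z -> z -- y -> x != y ->
  phi [set x; z] != phi [set z; y] -> loose_joined phi x y.
Proof.
move=> xz zy xy c; apply: (@loose_joinedI _ _ _ [:: z; y]) => //=.
- by rewrite xz zy.
- by rewrite !inE negb_or xy !adj_neq.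
- by rewrite /loose /= inE c.
Qed.

Lemma loose3 (cs : seq 'I_k.+1) a b c :
  uniq [:: a; b; c] -> {subset [:: a; b; c] <= cs} -> loose cs.
Proof.
move=> u s; apply/orP; right; apply/orP; right.
rewrite (uniq_leq_size u s) /= (uniq_leq_size u) // => z /s.
by rewrite mem_undup.
Qed.

(** Without colour 0 there remain the [k] values in the image of [lift ord0]. *)
Lemma size_positive_colours (s : seq 'I_k.+1) : uniq s ->
  (forall c, c \in s -> 0 < c) -> size s <= k.
Proof.
move=> us pos; have := @uniq_leq_size _ s (map (lift ord0) (enum 'I_k)) us.
rewrite size_map size_enum_ord; apply=> c /pos c0.
have : c \in enum 'I_k.+1 by rewrite mem_enum.
by rewrite enum_ordSl inE => /orP[/eqP E|//]; rewrite E in c0.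
Qed.

(** Three distinct colours are out of reach, so a loose path between nonadjacent vertices has
    exactly two edges. The lower bounds 2 for non-complete graphs and 3 for the 5-cycle rest on
    this. *)
Lemma loose_joined_le2 phi x y : k <= 2 -> edge_colouring phi -> x != y ->
  ~~ (x -- y) -> loose_joined phi x y ->
  exists z, [/\ x -- z, z -- y & phi [set x; z] != phi [set z; y]].
Proof.
move=> k2 /forall_inP pos xy nxy /existsP[[p sp] /= /and4P[px up /eqP ly]].
have cpos c u q : path (@adj G) u q -> c \in path_colours phi u q -> 0 < c.
  elim: q u => //= v q IH u /andP[uv vq]; rewrite inE => /orP[/eqP->|].
    by apply: pos; rewrite mem_edges.
  exact: IH.
case/or3P.
- rewrite size_pairmap; case: p {sp} px up ly => [|z [|]] //=.
  by rewrite andbT => xz _ E; rewrite -E xz in nxy.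
- rewrite size_pairmap; case: p {sp} px up ly => [|z [|y' [|]]] //=.
  move=> /and3P[xz zy _] _ <-; rewrite inE andbT => c.
  by exists z.
- case/andP=> _ /leq_trans le3.
  have: size (undup (path_colours phi x p)) <= k.
    apply: size_positive_colours (undup_uniq _) _ => c; rewrite mem_undup.
    exact: cpos.
  by move/le3 => k3; have := leq_trans k3 k2.
Qed.

Lemma loose_colourableI phi : edge_colouring phi ->
  (forall x y, x != y -> ~~ (x -- y) -> loose_joined phi x y) ->
  loose_colourable G k.
Proof.
move=> pos H; apply/existsP; exists phi; rewrite pos /=.
apply/forallP=> x; apply/forallP=> y; apply/implyP=> xy.
by have [/loose_joined1|] := boolP (x -- y); [apply|exact: H].
Qed.

End Loose.

Lemma edges_pair (G : sgraph) (A : {set G}) : A \in edges G ->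
  exists x y, x -- y /\ A = [set x; y].
Proof.
by rewrite inE => /existsP[x /existsP[y /andP[xy /eqP->]]]; exists x, y.
Qed.

Lemma lec_ge1 (G : sgraph) (x y : G) : connected G -> x -- y -> 0 < lec G.
Proof.
move=> conn xy; have [+ _] := lecP conn; case: (lec G) => // /existsP[phi].
case/andP=> /forall_inP/(_ [set x; y]); rewrite mem_edges => /(_ xy).
by rewrite ord1.
Qed.

Lemma lec_ge2 (G : sgraph) (x y : G) : connected G -> x != y -> ~~ (x -- y) ->
  1 < lec G.
Proof.
move=> conn xy nxy; have [/existsP[phi /andP[pos all]] _] := lecP conn.
rewrite ltnNge; apply/negP => k1.
have /forallP/(_ y)/implyP/(_ xy) j := forallP all x.
have [z [xz zy /eqP]] := loose_joined_le2 (leqW k1) pos xy nxy j; apply.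
have le1 A : A \in edges G -> phi A = 1 :> nat.
  move=> AE; apply/eqP; rewrite eqn_leq (forall_inP pos) // andbT.
  by apply: leq_trans k1; rewrite -ltnS.
by apply: val_inj; rewrite /= !le1 ?mem_edges.
Qed.

Lemma lec_complete (G : sgraph) : connected G ->
  (exists2 n, 2 <= n & sg_iso G (complete n)) -> lec G = 1.
Proof.
move=> conn [n n2 iso]; have E := complete_adj iso.
case: iso => f [g gK fK] _; apply/eqP; rewrite eqn_leq; apply/andP; split.
  have [_ ->//] := lecP conn.
  apply: (@loose_colourableI _ _ [ffun=> ord_max]) => [|x y xy].
    by apply/forall_inP=> A _; rewrite ffunE.
  by rewrite E xy.
case: n n2 f g gK fK => [|[|n]] //= _ f g gK fK.
apply: (@lec_ge1 _ (g ord0) (g ord_max)) => //.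
by rewrite E (can_eq fK).
Qed.

(** * Cut-edges *)

(** Deleting the only edge at [v] isolates [v], so its component and that of [u] have different
    roots, whereas [G] has a single component. *)
Lemma leaf_cut_edge (G : sgraph) (u v : G) : connected G -> u -- v ->
  (forall w, v -- w -> w = u) -> cut_edge [set u; v].
Proof.
move=> conn uv leaf; rewrite /cut_edge mem_edges uv /=.
set e := del_edge _.
have se : connect_sym e.
  apply: sym_connect_sym => x y.
  by rewrite /e /del_edge /= adj_sym [[set x; y]]setUC.
have sa : connect_sym (@adj G) by apply/sym_connect_sym/adj_sym.
have -> : n_comp (@adj G) predT = 1.
  rewrite -(n_comp_connect sa u); apply: eq_n_comp_r => w; apply/esym.
  by case/andP: conn => _ /forallP/(_ u)/forallP/(_ w).
have nuv : ~~ connect e v u.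
  apply/connectP => -[[|w p]] /=.
    by move=> _ E; move/adj_neq: uv; rewrite E eqxx.
  case/andP=> /andP[/leaf ->]; by rewrite setUC eqxx.
rewrite /n_comp_mem.
apply: (@leq_trans #|[set root e u; root e v]|).
  by rewrite cards2 eq_sym (root_connect se) nuv.
apply: subset_leq_card; apply/subsetP=> w; rewrite !inE andbT.
by case/orP=> /eqP->; apply: roots_root.
Qed.

(** Two such vertices are joined by a single path, through [u], so the edges from [u] to them need
    distinct colours. *)
Definition leaves (G : sgraph) (u : G) : {set G} :=
  [set v | (u -- v) && [forall w, (v -- w) ==> (w == u)]].

Lemma leavesP (G : sgraph) (u v : G) :
  reflect (u -- v /\ forall w, v -- w -> w = u) (v \in leaves u).
Proof.
rewrite inE; apply: (iffP andP) => -[uv H]; split=> //.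
  by move=> w vw; apply/eqP; move/forallP/(_ w)/implyP: H; apply.
by apply/forallP=> w; apply/implyP=> /H/eqP.
Qed.

(** Each edge from [u] to a leaf is a cut-edge, so the leaves are neighbours of [u] in
    [cut_graph G]. Some leaf [v0] serves to make [u] a vertex of that graph. *)
Lemma leaves_max_degree (G : sgraph) (u : G) : connected G ->
  #|leaves u| <= max_degree (cut_graph G).
Proof.
move=> conn; have [->|[v0 v0L]] := set_0Vmem (leaves u); first by rewrite cards0.
have cut v : v \in leaves u -> cut_edge [set u; v].
  by case/leavesP=> uv leaf; apply: leaf_cut_edge.
have vtx v w : v \in leaves u -> w \in [set u; v] ->
    [exists A : {set G}, cut_edge A && (w \in A)].
  by move=> /cut c wA; apply/existsP; exists [set u; v]; rewrite c.
pose U : cut_graph G := Sub u (vtx v0 u v0L (set21 _ _)).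
apply: leq_trans (leq_bigmax (F := fun x => #|[set y | x -- y]|) U).
rewrite -(card_imset _ val_inj); apply: subset_leq_card; apply/subsetP=> v vL.
apply/imsetP; exists (Sub v (vtx v v vL (set22 _ _))); last by rewrite SubK.
by rewrite inE /= /cut_adj /= cut.
Qed.

Lemma max_degree_cut_graph (G : sgraph) :
  max_degree (cut_graph G) <= max_degree G.
Proof.
apply/bigmax_leqP => x _.
apply: leq_trans (leq_bigmax (F := fun x => #|[set y | x -- y]|) (val x)).
rewrite -(card_imset _ val_inj); apply: subset_leq_card; apply/subsetP=> _ /imsetP[y + ->].
by rewrite !inE /= /cut_adj /= => /andP[]; rewrite mem_edges.
Qed.

(** * Graphs with a universal vertex *)

(* Ore: the complement of a minimal dominating set dominates the vertices that
   are not isolated. *)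
Lemma two_domination (T : finType) (e : rel T) : symmetric e -> irreflexive e ->
  exists D : {set T}, forall x y, e x y ->
    exists2 z, e x z & (z \in D) = (x \notin D).
Proof.
move=> esym eirr.
pose dom (D : {set T}) :=
  [forall x, forall y, (x \notin D) && e x y ==> [exists z in D, e x z]].
have domT : dom setT.
  by apply/forallP=> x; apply/forallP=> y; rewrite in_setT.
have [D /minsetP[domD minD] _] := minset_exists domT.
have domDP x y : x \notin D -> e x y -> exists2 z, z \in D & e x z.
  move=> xD xy; have /forallP/(_ y)/implyP := forallP domD x.
  by rewrite xD xy => /(_ isT)/exists_inP.
exists D => x y xy; have [xD|xD] := boolP (x \in D); last first.
  by have [z zD xz] := domDP _ _ xD xy; exists z.
have [/exists_inP[z xz zD]|N] := boolP [exists z in e x, z \notin D].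
  by exists z => //; apply: negbTE.
have inD z : e x z -> z \in D.
  move=> xz; apply: contraNT N => zD; by apply/exists_inP; exists z.
(* As all neighbours of [x] lie in [D], removing [x] keeps [D] dominating, against minimality: [y]
   dominates [x], and no vertex outside [D] relied on [x]. *)
suff /minD/(_ (subD1set _ _)) E : dom (D :\ x) by rewrite -E setD11 in xD.
apply/forallP=> w; apply/forallP=> w'; apply/implyP=> /andP[].
have [-> _ _|wx] := eqVneq w x.
  apply/exists_inP; exists y => //; rewrite in_setD1 inD // andbT.
  by apply: contraTneq xy => ->; rewrite eirr.
rewrite in_setD1 wx /= => wD /(domDP _ _ wD)[z zD wz].
apply/exists_inP; exists z => //; rewrite in_setD1 zD andbT.
by apply: contraNneq wD => zx; apply: inD; rewrite esym -zx.
Qed.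

Lemma universal_colourable (G : sgraph) (u : G) k :
  (forall x, x != u -> u -- x) -> 3 <= k -> #|leaves u| <= k ->
  loose_colourable G k.
Proof.
move=> univ k3 kL; pose e := [rel x y : G | [&& x -- y, x != u & y != u]].
have [||D domD] := @two_domination G e.
- by move=> x y; rewrite /= adj_sym [(x != _) && _]andbC.
- by move=> x; rewrite /= adj_irrefl.
(* Leaf indices are shifted by one to avoid colour 0; they stay within [k] because there are at most
   [k] leaves. *)
pose g x := if x \in leaves u then (index x (enum (leaves u))).+1
            else if x \in D then 1 else 2.
have ltg x : 0 < g x <= k.
  rewrite /g; case: ifP => [xL|_]; last by case: ifP => _; apply: leq_trans k3.
  by apply: leq_trans kL; rewrite cardE index_mem mem_enum.
(* An edge at [u] is coloured by its other end; the default 0 only concerns [[set u]]. *)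
pose phi : {ffun {set G} -> 'I_k.+1} := [ffun A : {set G} =>
  if u \in A then inord (if [pick x in A :\ u] is Some x then g x else 0)
  else inord 3].
have phiu x : x != u -> phi [set u; x] = g x :> nat.
  move=> xu; rewrite ffunE set21; case: pickP => [y|/(_ x)].
    rewrite !inE => /andP[/negPf-> /= /eqP->].
    by rewrite inordK // ltnS; case/andP: (ltg x).
  by rewrite !inE xu eqxx orbT.
have phin x y : x != u -> y != u -> phi [set x; y] = 3 :> nat.
  move=> xu yu; rewrite ffunE !inE ![u == _]eq_sym (negPf xu) (negPf yu) /=.
  by rewrite inordK.
(* The neighbour [y] in the opposite class is no leaf, being adjacent to [x], so [g x] and [g y] are
   1 and 2 in some order. *)
have nonleaf x : x != u -> x \notin leaves u -> exists y,
    [/\ x -- y, y != u & uniq [:: g x; g y; 3]].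
  move=> xu xL; have: ~~ [forall w, (x -- w) ==> (w == u)].
    by apply: contraNN xL; rewrite inE univ.
  rewrite negb_forall => /existsP[w]; rewrite negb_imply => /andP[xw wu].
  have [|y /and3P[xy _ yu] yD] := domD x w; first by rewrite /= xw xu.
  exists y; split=> //; rewrite /g (negPf xL).
  have /negPf -> : y \notin leaves u.
    apply/negP => /leavesP[_ /(_ x)]; rewrite adj_sym => /(_ xy) E.
    by rewrite E eqxx in xu.
  by rewrite yD; case: (x \in D).
apply: (@loose_colourableI _ _ phi).
  apply/forall_inP=> _ /edges_pair[x [y [xy ->]]].
  have [xE|xu] := eqVneq x u.
    have yu : y != u by rewrite -xE eq_sym adj_neq.
    by rewrite xE phiu //; case/andP: (ltg y).
  have [->|yu] := eqVneq y u; last by rewrite phin.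
  by rewrite setUC phiu //; case/andP: (ltg x).
move=> x y xy nxy.
have xu : x != u by apply: contraNneq nxy => xE; rewrite xE univ // -xE eq_sym.
have yu : y != u by apply: contraNneq nxy => yE; rewrite yE adj_sym univ // -yE.
have ux := univ x xu; have uy := univ y yu.
have xu' : x -- u by rewrite adj_sym.
have [gxy|gxy] := eqVneq (g x) (g y); last first.
  apply: (loose_joined2 xu' uy) => //.
  by rewrite -val_eqE /= setUC !phiu.
(* Distinct leaves have distinct colours, so one of [x], [y] is not a leaf; by reversing paths it
   may be taken to be [y]. *)
wlog yL : x y xy nxy xu yu ux uy xu' gxy / y \notin leaves u.
  move=> IH; have [yL|yL] := boolP (y \in leaves u); last exact: IH.
  have [xL|xL] := boolP (x \in leaves u).
    move: gxy; rewrite /g xL yL => -[] /index_inj E.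
    by rewrite E ?eqxx ?mem_enum in xy.
  by apply/loose_joinedC/IH; rewrite // 1?eq_sym 1?adj_sym // adj_sym.
have [y' [yy' y'u c]] := nonleaf _ yu yL.
apply: (@loose_joinedI _ _ _ _ _ [:: u; y'; y]) => //=.
- by rewrite xu' univ // adj_sym yy'.
- rewrite !inE !negb_or xu xy [u == y']eq_sym y'u (adj_neq uy) eq_sym.
  rewrite [y' == y]eq_sym (adj_neq yy') !andbT /=.
  (* If [y'] were [x], then [g y'] would equal [g y], against [c]. *)
  by apply: contraTneq c => ->; rewrite gxy /= inE eqxx.
- apply: (@loose3 _ _ (phi [set x; u]) (phi [set u; y']) (phi [set y'; y])).
    rewrite -(map_inj_uniq val_inj) /= (phin y' y) //.
    by rewrite [[set x; u]]setUC !phiu // gxy.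
  by move=> z.
Qed.

(** * Graphs without a universal vertex *)

(** When [s -- t], reversing the first path, crossing this edge and following the second gives a
    path from [x] to [y]. *)
Definition linked (G : sgraph) (s x t y : G) : Prop :=
  exists P Q, [/\ path (@adj G) s P, path (@adj G) t Q, last s P = x,
                  last t Q = y & uniq (s :: P ++ t :: Q)].

Lemma linkedC (G : sgraph) (s x t y : G) : linked s x t y -> linked t y s x.
Proof.
case=> P [Q [pP pQ lP lQ u]]; exists Q, P; split=> //.
by rewrite -cat_cons uniq_catC.
Qed.

Ltac solve_neq :=
  let E := fresh "E" in
  apply/eqP => E; subst;
  match goal with
  | H : is_true (?a -- ?a) |- _ => by rewrite adj_irrefl in H
  | H : is_true (?a != ?a) |- _ => by rewrite eqxx in H
  | H1 : is_true (?a -- ?b), H2 : is_true (~~ (?a -- ?b)) |- _ =>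
      by rewrite H1 in H2
  | H1 : is_true (?a -- ?b), H2 : is_true (~~ (?b -- ?a)) |- _ =>
      by rewrite adj_sym H1 in H2
  end.

(** [P] and [Q] list the vertices after [s] and [t]; disjointness reduces to inequalities decided by
    the known adjacencies and non-adjacencies. *)
Ltac link P Q :=
  exists P, Q; split=> //=;
  [ do ?[apply/andP; split] => //; by rewrite adj_sym
  | do ?[apply/andP; split] => //; by rewrite adj_sym
  | rewrite ?inE ?negb_or; do ?[apply/andP; split] => //; solve_neq ].

Section Linking.
Variable G : sgraph.
Hypothesis w2 : forall x y : G, within2 x y.
Hypothesis nuniv : forall u : G, exists2 z, z != u & ~~ (u -- z).

Let common (x y : G) : x != y -> ~~ (x -- y) -> exists2 z, x -- z & z -- y.
Proof. by move=> xy nxy; case: (w2 x y) => // E; [rewrite E eqxx in xy|rewrite E in nxy]. Qed.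

(** The edge [s -- x] is one path if [y] is reached from [t] without [s]. Otherwise [s] is adjacent
    to [y] and to [t]; then [s -- y] is one path and [t] has to reach [x] without [s]. *)
Lemma linked_adj (s t x y : G) : s != t -> x != t -> y != t -> y != s ->
  x != y -> ~~ (x -- y) -> x -- s -> linked s x t y \/ linked s y t x.
Proof.
move=> st xt yt ys xy nxy xs.
have [ty|nty] := boolP (t -- y); first by left; link [:: x] [:: y].
have ty : t != y by rewrite eq_sym.
have [q tq qy] := common ty nty.
have [qs|qs] := eqVneq q s; last by left; link [:: x] [:: q; y].
subst q; have [tx|ntx] := boolP (t -- x); first by right; link [:: y] [:: x].
(* Since [s] is no neighbour of [z], walks of at most two edges from [z] to [t] and to [x] avoid
   [s]; if both have the same middle vertex, [z] is skipped. *)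
have [z zs nsz] := nuniv s.
have [E|zt|[r zr rt]] := w2 z t; first by rewrite E adj_sym tq in nsz.
  have [E|zx|[x' zx' x'x]] := w2 z x; first by rewrite E adj_sym xs in nsz.
    by right; link [:: y] [:: z; x].
  by right; link [:: y] [:: z; x'; x].
have [E|zx|[x' zx' x'x]] := w2 z x; first by rewrite E adj_sym xs in nsz.
  by right; link [:: y] [:: r; z; x].
have [E|rx'] := eqVneq r x'; first by subst r; right; link [:: y] [:: x'; x].
have [zt|nzt] := eqVneq z t; first by subst z; rewrite adj_sym tq in nsz.
by right; link [:: y] [:: r; z; x'; x].
Qed.

Lemma linked_nonadj (s t x y : G) : s != t -> x != s -> x != t -> y != s ->
  y != t -> x != y -> ~~ (x -- y) -> ~~ (x -- s) -> ~~ (x -- t) ->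
  ~~ (y -- s) -> ~~ (y -- t) -> linked s x t y \/ linked s y t x.
Proof.
move=> st xs xt ys yt xy nxy nxs nxt nys nyt.
have [p xp ps] := common xs nxs; have [q yq qt] := common yt nyt.
have [E|pq] := eqVneq p q; last by left; link [:: p; x] [:: q; y].
(* Here [p] is adjacent to all of [x], [y], [s], [t]. One pair is joined through [p], the other
   through [z] or neighbours of [z], none of which is [p]. *)
subst q; have [z zp npz] := nuniv p.
have zx : z != x by solve_neq.
have zs : z != s by solve_neq.
have zy : z != y by solve_neq.
have zt' : z != t by solve_neq.
have [zt|nzt] := boolP (z -- t).
  have [zx'|nzx] := boolP (z -- x); first by right; link [:: p; y] [:: z; x].
  have [x' zx' x'x] := common zx nzx.
  by right; link [:: p; y] [:: z; x'; x].
have [zs'|nzs] := boolP (z -- s).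
  have [zx'|nzx] := boolP (z -- x); first by left; link [:: z; x] [:: p; y].
  have [x' zx' x'x] := common zx nzx.
  by left; link [:: z; x'; x] [:: p; y].
have [s' zs' s's] := common zs nzs.
have [zx'|nzx] := boolP (z -- x); first by left; link [:: s'; z; x] [:: p; y].
have [x' zx' x'x] := common zx nzx.
have [E|s'x'] := eqVneq s' x'; first by subst s'; left; link [:: x'; x] [:: p; y].
by left; link [:: s'; z; x'; x] [:: p; y].
Qed.

(** Exchanging [s] with [t], or [x] with [y], preserves the pair of alternatives, so any adjacency
    between the two pairs reduces to [x -- s]. *)
Lemma linked_total (s t x y : G) : s != t -> x != s -> x != t -> y != s ->
  y != t -> x != y -> ~~ (x -- y) -> linked s x t y \/ linked s y t x.
Proof.
move=> st xs xt ys yt xy nxy.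
have ts : t != s by rewrite eq_sym.
have yx : y != x by rewrite eq_sym.
have nyx : ~~ (y -- x) by rewrite adj_sym.
have [a|nxs] := boolP (x -- s); first exact: linked_adj.
have [a|nxt] := boolP (x -- t).
  by case: (linked_adj ts xs ys yt xy nxy a) => /linkedC; [right|left].
have [a|nys] := boolP (y -- s).
  by case: (linked_adj st yt xt xs yx nyx a); [right|left].
have [a|nyt] := boolP (y -- t).
  by case: (linked_adj ts ys xs xt yx nyx a) => /linkedC; [left|right].
exact: linked_nonadj.
Qed.

End Linking.

(** As [x != s] and [y != t], both paths have an edge, so the combined path runs through some [u],
    [s], [t], [v] in a row. Disjointness gives [u != t] and [v != s], and these three edges already
    carry three colours. *)
Lemma linked_loose (G : sgraph) k (phi : {ffun {set G} -> 'I_k.+1})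
    (s t x y : G) : s -- t -> x != s -> y != t -> linked s x t y ->
  (forall u v, u != t -> v != s ->
     uniq [:: phi [set u; s]; phi [set s; t]; phi [set t; v]]) ->
  loose_joined phi x y.
Proof.
move=> st xs yt [P [Q [pP pQ lP lQ uPQ]]] c.
have [P' [pP' lP' eP']] : exists P', [/\ path (@adj G) x P', last x P' = s &
    x :: P' = rev (s :: P)].
  exists (rev (belast s P)); split.
  - rewrite -lP rev_path; apply: sub_path pP => u v; by rewrite adj_sym.
  - by case: P {uPQ pP} lP xs => [<-|a P _ _]; rewrite ?eqxx //= rev_cons last_rcons.
  - by rewrite (lastI s P) rev_rcons lP.
have {}uPQ : uniq (x :: P' ++ t :: Q).
  rewrite -cat_cons eP' (perm_uniq (s2 := (s :: P) ++ t :: Q)) //.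
  by rewrite perm_cat2r perm_rev.
case/lastP: P' => [|P' s'] in pP' lP' eP' uPQ; first by rewrite -lP' eqxx in xs.
rewrite last_rcons in lP'; subst s'.
case: Q => [|v Q] in pQ lQ uPQ; first by rewrite -lQ eqxx in yt.
apply: (@loose_joinedI _ _ _ _ _ (rcons P' s ++ [:: t, v & Q])) => //.
- by rewrite cat_path pP' last_rcons /= st.
- by rewrite last_cat.
apply: (@loose3 _ _ (phi [set last x P'; s]) (phi [set s; t]) (phi [set t; v])).
  move: uPQ; rewrite -cat_cons cat_uniq -rcons_cons => /and3P[_ /hasPn N _].
  have tP := N t (mem_head _ _); have vP : v \notin rcons (x :: P') s.
    by apply: N; rewrite !inE eqxx orbT.
  rewrite mem_rcons inE negb_or /= in tP; case/andP: tP => _ tP.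
  apply: c; first by apply: contraNneq tP => <-; apply: mem_last.
  by apply: contraNneq vP => ->; rewrite mem_rcons mem_head.
rewrite /path_colours pairmap_cat last_rcons -cats1 pairmap_cat /=.
by move=> z; rewrite !inE !mem_cat !inE => /or3P[]->; rewrite ?orbT.
Qed.

Lemma nonuniversal_colourable (G : sgraph) k : 3 <= k -> 0 < #|G| ->
  (forall x y : G, within2 x y) ->
  (forall u : G, exists2 z, z != u & ~~ (u -- z)) -> loose_colourable G k.
Proof.
move=> k3 /card_gt0P[s _] w2 nuniv.
have [t st] : exists t, s -- t.
  have [z zs nsz] := nuniv s.
  case: (w2 s z) => [E|E|[t st _]]; last by exists t.
    by rewrite E eqxx in zs.
  by rewrite E in nsz.
have s't := adj_neq st; have t's : t != s by rewrite eq_sym.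
(* The edge [st] is tested first because it contains [t] as well. *)
pose phi : {ffun {set G} -> 'I_k.+1} := [ffun A : {set G} =>
  inord (if A == [set s; t] then 1 else if t \in A then 3 else 2)].
have cE i : i <= 3 -> (inord i : 'I_k.+1) = i :> nat.
  by move=> i3; rewrite inordK // ltnS (leq_trans i3).
have phi1 : phi [set s; t] = 1 :> nat by rewrite ffunE eqxx cE.
have phi3 v : v != s -> phi [set t; v] = 3 :> nat.
  move=> vs; rewrite ffunE set21 ifN ?cE //; apply/eqP => /setP/(_ s).
  by rewrite !inE eqxx (negPf s't) eq_sym (negPf vs).
have phi2 u v : u != t -> v != t -> phi [set u; v] = 2 :> nat.
  move=> ut vt; have tN : t \notin [set u; v].
    by rewrite !inE negb_or eq_sym ut eq_sym.
  rewrite ffunE ifN ?(negPf tN) ?cE //; apply: contraNneq tN => ->.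
  exact: set22.
apply: (@loose_colourableI _ _ phi).
  by apply/forall_inP=> A _; rewrite ffunE cE; do ?case: ifP.
(* The path is [s t y] with colours 1, 3, or [s t w y] with colours 1, 3, 2. *)
have from_s y : y != s -> ~~ (s -- y) -> loose_joined phi s y.
  move=> ys nsy; have [ty|nty] := boolP (t -- y).
    by apply: (loose_joined2 st ty); rewrite ?[s == y]eq_sym // -val_eqE /= phi1 phi3.
  have yt : y != t by apply: contraNneq nsy => ->.
  have [E|E|[w tw wy]] := w2 t y; first by rewrite E eqxx in yt.
    by rewrite E in nty.
  have ws : w != s by apply: contraNneq nsy => <-.
  apply: (@loose_joinedI _ _ _ _ _ [:: t; w; y]) => //=.
  - by rewrite st tw wy.
  - rewrite !inE !negb_or s't ![s == _]eq_sym ws ys [t == y]eq_sym yt.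
    by rewrite (adj_neq tw) (adj_neq wy).
  - apply: (@loose3 _ _ (phi [set s; t]) (phi [set t; w]) (phi [set w; y])) => //.
    rewrite -(map_inj_uniq val_inj) /= phi1 phi3 // phi2 //.
    by rewrite eq_sym adj_neq.
(* In the path [t w y] the second edge has colour 2, the first colour 1 if [w] is [s] and 3
   otherwise. *)
have from_t y : y != t -> ~~ (t -- y) -> loose_joined phi t y.
  move=> yt nty; have [E|E|[w tw wy]] := w2 t y; first by rewrite E eqxx in yt.
    by rewrite E in nty.
  have wt : w != t by rewrite eq_sym adj_neq.
  apply: (loose_joined2 tw wy); first by rewrite eq_sym.
  rewrite -val_eqE /= (phi2 w y) //.
  by have [->|ws] := eqVneq w s; [rewrite setUC phi1|rewrite phi3].
move=> x y xy nxy.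
have yx : y != x by rewrite eq_sym.
have nyx : ~~ (y -- x) by rewrite adj_sym.
have [E|xs] := eqVneq x s; first by subst x; apply: from_s.
have [E|ys] := eqVneq y s; first by subst y; apply/loose_joinedC/from_s.
have [E|xt] := eqVneq x t; first by subst x; apply: from_t.
have [E|yt] := eqVneq y t; first by subst y; apply/loose_joinedC/from_t.
have c u v : u != t -> v != s ->
    uniq [:: phi [set u; s]; phi [set s; t]; phi [set t; v]].
  by move=> ut vs; rewrite -(map_inj_uniq val_inj) /= phi1 phi2 // phi3.
case: (linked_total w2 nuniv s't xs xt ys yt xy nxy) => l.
  exact: linked_loose st xs yt l c.
exact/loose_joinedC/(linked_loose st ys xt l c).
Qed.

(** * Stars and the 5-cycle *)

(** [None] is the centre and the [Some i] are the [d] leaves. *)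
Definition star_rel d : rel (option 'I_d) := [rel x y | isSome x != isSome y].

Lemma star_sym d : symmetric (@star_rel d).
Proof. by move=> x y; rewrite /star_rel /= eq_sym. Qed.

Lemma star_irrefl d : irreflexive (@star_rel d).
Proof. by move=> x; rewrite /star_rel /= eqxx. Qed.

Definition star d : sgraph := SGraph (@star_sym d) (@star_irrefl d).

Lemma card_star d : #|star d| = d.+1.
Proof. by rewrite card_option card_ord. Qed.

Lemma star_within2 d (x y : star d) : within2 x y.
Proof.
case: x y => [i|] [j|]; try by [constructor 1|constructor 2].
by constructor 3; exists (None : star d).
Qed.

Lemma star_connected d : connected (star d).
Proof. by apply: within2_connected (@star_within2 d); rewrite card_star. Qed.

Lemma star_nonadj d : 2 <= d -> exists x y : star d, x != y /\ ~~ (x -- y).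
Proof.
case: d => [|[|d]] // _.
by exists (Some ord0 : star d.+2), (Some ord_max : star d.+2).
Qed.

Lemma star_max_degree d : max_degree (cut_graph (star d)) = d.
Proof.
apply/eqP; rewrite eqn_leq; apply/andP; split.
  apply: leq_trans (max_degree_cut_graph _) _; apply/bigmax_leqP => x _.
  rewrite [leqRHS](_ : d = #|[set~ x]|); last by rewrite cardsC1 card_star.
  apply: subset_leq_card; apply/subsetP=> y; rewrite !inE.
  by move/adj_neq; rewrite eq_sym.
apply: leq_trans (leaves_max_degree (None : star d) (star_connected d)).
rewrite -[X in X <= _]card_ord -cardsT -(card_imset _ (@Some_inj _)).
apply: subset_leq_card; apply/subsetP=> _ /imsetP[i _ ->].
by apply/leavesP; split=> // -[j|].
Qed.

Lemma star_lec d : 2 <= d -> lec (star d) = d.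
Proof.
move=> d2; have [/existsP[phi /andP[/forall_inP pos all]] minl] :=
  lecP (star_connected d).
pose f (i : 'I_d) := phi [set (None : star d); Some i].
apply/eqP; rewrite eqn_leq; apply/andP; split.
  apply: minl.
  (* An edge is coloured by its leaf, with [lift ord0] moving the leaf numbers past colour 0. *)
  pose psi : {ffun {set star d} -> 'I_d.+1} := [ffun A : {set star d} =>
    if [pick i | Some i \in A] is Some i then lift ord0 i else ord0].
  have psiE i : psi [set (None : star d); Some i] = lift ord0 i.
    rewrite ffunE; case: pickP => [j|/(_ i)]; last by rewrite !inE eqxx.
    by rewrite !inE /= => /eqP[->].
  apply: (@loose_colourableI _ _ psi).
    apply/forall_inP=> _ /edges_pair[[i|] [[j|] [//= _ ->]]].
      by rewrite setUC psiE.
    by rewrite psiE.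
  move=> [i|] [j|] //= ij _; apply: (@loose_joined2 (star d) _ _ _ None) => //.
  by rewrite setUC !psiE (inj_eq lift_inj).
have fI : injective f.
  move=> i j fij; apply/eqP; apply: contraT => ij.
  have /forallP/(_ (Some j))/implyP/(_ ij) := forallP all (Some i).
  case/existsP=> -[p sp] /= /andP[px /andP[up /andP[/eqP ly]]].
  (* From a leaf, every second vertex of a path is [None], so without repetition a path between two
     leaves has just two edges. *)
  case: p {sp} px up ly => [|[a|] [|[b|] [|[c|] p]]] //= _ up.
    by case=> ->; rewrite /loose /= inE [[set Some i; _]]setUC -/(f i) -/(f j) fij eqxx.
  by move: up; rewrite !inE /= !andbF.
have := @size_positive_colours _ (codom f); rewrite size_codom card_ord; apply.
  by rewrite map_inj_uniq ?enum_uniq.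
by move=> _ /codomP[i ->]; apply: pos; rewrite mem_edges.
Qed.

Definition cycle5_rel : rel 'I_5 := [rel x y | (y == ordS x) || (x == ordS y)].

Lemma cycle5_sym : symmetric cycle5_rel.
Proof. by move=> x y; rewrite /cycle5_rel /= orbC. Qed.

Lemma cycle5_irrefl : irreflexive cycle5_rel.
Proof. by move=> [[|[|[|[|[|x]]]]] ?]. Qed.

Definition cycle5 : sgraph := SGraph cycle5_sym cycle5_irrefl.

Lemma cycle5_within2 (x y : cycle5) : within2 x y.
Proof.
by case: x y => [[|[|[|[|[|x]]]]] ?] [[|[|[|[|[|y]]]]] ?] //;
  first [ by constructor 1; apply: val_inj
        | by constructor 2
        | by constructor 3; exists (@Ordinal 5 0 isT : cycle5)
        | by constructor 3; exists (@Ordinal 5 1 isT : cycle5)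
        | by constructor 3; exists (@Ordinal 5 2 isT : cycle5)
        | by constructor 3; exists (@Ordinal 5 3 isT : cycle5)
        | by constructor 3; exists (@Ordinal 5 4 isT : cycle5) ].
Qed.

Lemma cycle5_connected : connected cycle5.
Proof. by apply: within2_connected cycle5_within2; rewrite card_ord. Qed.

Lemma cycle5_max_degree : max_degree cycle5 <= 2.
Proof.
apply/bigmax_leqP => x _; apply: (@leq_trans #|[set ordS x; ord_pred x]|).
  apply: subset_leq_card; apply/subsetP=> y; rewrite !inE /= /cycle5_rel /=.
  by case/orP=> [->//|/eqP->]; rewrite ordSK eqxx orbT.
by rewrite cards2; case: (_ != _).
Qed.

(** A vertex and its second successor have a single common neighbour, so two colours would have to
    alternate around a cycle of odd length. *)
Lemma cycle5_lec : 2 < lec cycle5.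
Proof.
have [/existsP[phi /andP[pos all]] _] := lecP cycle5_connected.
rewrite ltnNge; apply/negP => k2.
pose c (x : cycle5) : nat := phi [set x; (ordS x : cycle5)].
have c12 x : c x = 1 \/ c x = 2.
  have : 0 < c x by apply: (forall_inP pos); rewrite mem_edges /= /cycle5_rel /= eqxx.
  have : c x <= 2 by apply: leq_trans k2; rewrite -ltnS ltn_ord.
  by case: (c x) => [|[|[|]]] // _ _; [left|right].
have cS x : c x <> c (ordS x).
  have xS : (x : cycle5) != ordS (ordS x) by case: x => [[|[|[|[|[|x]]]]] ?].
  have nxS : ~~ ((x : cycle5) -- ordS (ordS x)) by case: x {xS} => [[|[|[|[|[|x]]]]] ?].
  have /forallP/(_ (ordS (ordS x)))/implyP/(_ xS) j := forallP all x.
  have [z [xz zS]] := loose_joined_le2 k2 pos xS nxS j.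
  have -> : z = ordS x.
    apply: val_inj; move: xz zS {xS nxS j}.
    by case: x z => [[|[|[|[|[|x]]]]] ?] [[|[|[|[|[|z]]]]] ?].
  by move/eqP=> ne E; apply: ne; apply: val_inj.
have S5 : ordS (ordS (ordS (ordS (ordS ord0)))) = ord0 :> 'I_5 by apply: val_inj.
pose o : 'I_5 := ord0.
move: (cS o) (cS (ordS o)) (cS (ordS (ordS o))) (cS (ordS (ordS (ordS o))))
  (cS (ordS (ordS (ordS (ordS o))))).
rewrite S5.
by case: (c12 o) => ->; case: (c12 (ordS o)) => ->;
  case: (c12 (ordS (ordS o))) => ->; case: (c12 (ordS (ordS (ordS o)))) => ->;
  case: (c12 (ordS (ordS (ordS (ordS o))))) => ->.
Qed.

(** * The upper bound and the sharpness of all three bounds *)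

Lemma lec_diam2_le (G : sgraph) : connected G -> diam G <= 2 ->
  lec G <= maxn 3 (max_degree (cut_graph G)).
Proof.
move=> conn dG; have [_ ->//] := lecP conn.
have [/existsP[u /forallP univ]|N] :=
  boolP [exists u : G, forall x : G, (x != u) ==> (u -- x)].
  apply: (@universal_colourable _ u); rewrite ?leq_maxl //.
    by move=> x; apply/implyP.
  by apply: leq_trans (leq_maxr _ _); apply: leaves_max_degree.
apply: nonuniversal_colourable (leq_maxl _ _) _ (diam2_within2 conn dG) _.
  by case/andP: conn.
move=> u; move: N; rewrite negb_exists => /forallP/(_ u).
by rewrite negb_forall => /existsP[z]; rewrite negb_imply => /andP[]; exists z.
Qed.

Theorem theorem4 :
  (forall G : sgraph, connected G -> diam G <= 2 ->
     ((exists2 n, 2 <= n & sg_iso G (complete n)) -> lec G = 1) /\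
     (~ (exists2 n, 2 <= n & sg_iso G (complete n)) -> 2 <= #|G| ->
        2 <= lec G <= maxn 3 (max_degree (cut_graph G)))) /\
  (exists G : sgraph,
     [/\ connected G, diam G <= 2,
         ~ (exists2 n, 2 <= n & sg_iso G (complete n)) & lec G = 2]) /\
  (exists G : sgraph,
     [/\ connected G, diam G <= 2,
         ~ (exists2 n, 2 <= n & sg_iso G (complete n)),
         max_degree (cut_graph G) < 3 & lec G = 3]) /\
  (forall d : nat, 3 <= d ->
     exists G : sgraph,
     [/\ connected G, diam G <= 2,
         ~ (exists2 n, 2 <= n & sg_iso G (complete n)),
         max_degree (cut_graph G) = d & lec G = d]).
Proof.
have star_spec d : 2 <= d -> [/\ connected (star d), diam (star d) <= 2,
    ~ (exists2 n, 2 <= n & sg_iso (star d) (complete n)) & lec (star d) = d].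
  move=> d2; split; last exact: star_lec.
  - exact: star_connected.
  - by apply: within2_diam (@star_within2 d); rewrite card_star.
  - by have [x [y [xy nxy]]] := star_nonadj d2; apply: nonadj_not_complete nxy.
split=> [G conn dG|]; first split=> [|nK G2]; first exact: lec_complete.
  have [x [y [xy nxy]]] := not_complete_nonadj G2 nK.
  by rewrite (lec_ge2 conn xy nxy) lec_diam2_le.
(* The path on three vertices attains the value 2. *)
split; first by exists (star 2); apply: star_spec.
split; last first.
  move=> d d3; exists (star d); have [] := star_spec d (ltnW d3).
  by split=> //; apply: star_max_degree.
(* The degree 2 of the 5-cycle bounds that of its cut-edge graph, so the upper bound becomes 3 and
   meets [cycle5_lec]. *)
have deg := leq_trans (max_degree_cut_graph _) cycle5_max_degree.
have diam5 : diam cycle5 <= 2.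
  by apply: within2_diam cycle5_within2; rewrite card_ord.
exists cycle5; split=> //; first exact: cycle5_connected.
  by apply: (@nonadj_not_complete cycle5 (@Ordinal 5 0 isT) (@Ordinal 5 2 isT)).
apply/eqP; rewrite eqn_leq cycle5_lec andbT.
have := lec_diam2_le cycle5_connected diam5.
by rewrite (maxn_idPl _) // leqW.
Qed.
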